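(* Let $\mathcal{A}$ be a thick category of cubes which does not contain the symmetry maps, i.e. such that the only bijective map of $\mathcal{A}([n],[n])$ is $\mathrm{Id}_{[n]}$ for all $n\geq 0$. Then $\mathcal{A}\subset \widehat{\square}$. In other terms, $\widehat{\square}$ is the greatest, for the inclusion, thick category of cubes which does not contain any symmetry map.
   Context: For $n\geq 0$, $[n]=\{0<1\}^n$ with the product order, $[0]=\{()\}$. $\mathbf{PoSet}^+$ is the category of posets and strictly increasing maps. For $1\leq i\leq n$ and $\alpha\in\{0,1\}$, the coface map $\delta_i^\alpha:[n-1]\to[n]$ is $\delta_i^\alpha(x_1,\dots,x_{n-1})=(x_1,\dots,x_{i-1},\alpha,x_i,\dots,x_{n-1})$. $\square$ is the subcategory of $\mathbf{PoSet}^+$ with objects the $[n]$, $n\ge 0$, generated by the coface maps. For $x,x'\in[n]$ put $\vec d_1(x,x')=\sum_i|x_i-x'_i|$ if $x\leq x'$ and $\vec d_1(x,x')=\infty$ otherwise. A strictly increasing map $f:[m]\to[n]$ is cotransverse if for all $x,y\in[m]$, $\vec d_1(x,y)=1$ implies $\vec d_1(f(x),f(y))=1$. $\widehat{\square}_S$ is the category with objects the $[n]$, $n\geq 0$, and morphisms the cotransverse maps. A category of cubes is a small category $\mathcal{A}$ with $\square\subset\mathcal{A}\subset\widehat{\square}_S$ (same objects). The symmetry maps are the maps $\sigma_i:[n]\to[n]$ ($n\geq2$, $1\leq i\leq n-1$) exchanging the coordinates $x_i$ and $x_{i+1}$. Known fact: every cotransverse map $f:[m]\to[n]$ factors uniquely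 as $f=\phi\psi$ with $\psi:[m]\to[m]$ cotransverse and $\phi:[m]\to[n]$ in $\square$. A category of cubes $\mathcal{A}$ is thick if for every $f\in\mathcal{A}$, the map $\psi$ in this factorization belongs to $\mathcal{A}$. $\widehat{\square}$ is the category of cubes whose maps are the $\phi:[m]\to[n]$ in $\widehat{\square}_S$ such that for every $\delta:[p]\to[m]$ in $\square$, if $\phi\delta$ is one-to-one then $\phi\delta\in\square$. *)

(* Defs.v *)
From mathcomp Require Import all_boot all_order all_fingroup all_algebra.

Set Implicit Arguments.
Unset Strict Implicit.
Unset Printing Implicit Defensive.

(* [n] = {0 < 1}^n; on n.-tupleprod bool the canonical order (<=, < in scope
   order_scope) is the product order. *)
Definition cube (n : nat) := n.-tupleprod bool.

(* Arbitrary set maps [m] -> [n]; monotonicity is imposed by predicates.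
   Finite functions are used so that equality of maps is pointwise equality. *)
Definition cubemap (m n : nat) := {ffun cube m -> cube n}.

Definition cube_id (n : nat) : cubemap n n := [ffun x => x].

Definition cube_comp (m n p : nat) (g : cubemap n p) (f : cubemap m n) :
  cubemap m p := [ffun x => g (f x)].

(* Inserts the value a at position i, with positions counted from 0: the other
   coordinates of the result are x_0, x_1, ... in order. *)
Definition coface (n : nat) (i : 'I_n.+1) (a : bool) : cubemap n n.+1 :=
  [ffun x : cube n =>
     [tuple (if unlift i j is Some k then tnth x k else a) | j < n.+1]
     : cube n.+1].

(* Exchanges the adjacent positions i and i + 1 of [n + 1]. *)
Definition symmetry_map (n : nat) (i : 'I_n) : cubemap n.+1 n.+1 :=
  [ffun x : cube n.+1 =>
     [tuple tnth x (tperm (widen_ord (leqnSn n) i) (lift ord0 i) j) | j < n.+1]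
     : cube n.+1].

(* None stands for the value infinity. *)
Definition dist1 (n : nat) (x y : cube n) : option nat :=
  if (x <= y)%O then
    Some (\sum_(i < n) `|(tnth x i : nat) - (tnth y i : nat)|)%N
  else None.

Definition strictly_increasing (m n : nat) (f : cubemap m n) : Prop :=
  {homo f : x y / (x < y)%O}.

(* A family of sets of maps [m] -> [n]: the morphism sets of a prospective
   category whose objects are all the [n]. *)
Definition mapclass := forall m n : nat, cubemap m n -> Prop.

Definition subclass (A B : mapclass) : Prop :=
  forall (m n : nat) (f : cubemap m n), A m n f -> B m n f.

Definition is_category (A : mapclass) : Prop :=
  (forall n, A n n (cube_id n)) /\
  (forall m n p (g : cubemap n p) (f : cubemap m n),
     A n p g -> A m n f -> A m p (cube_comp g f)).

Inductive Box : mapclass :=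
| Box_coface n (i : 'I_n.+1) (a : bool) : Box (coface i a)
| Box_id n : Box (cube_id n)
| Box_comp m n p (g : cubemap n p) (f : cubemap m n) :
    Box g -> Box f -> Box (cube_comp g f).

Definition cotransverse : mapclass := fun m n f =>
  strictly_increasing f /\
  forall x y : cube m, dist1 x y = Some 1 -> dist1 (f x) (f y) = Some 1.

Definition category_of_cubes (A : mapclass) : Prop :=
  [/\ is_category A, subclass Box A & subclass A cotransverse].

Definition cube_factorization (m n : nat) (f : cubemap m n)
    (phi : cubemap m n) (psi : cubemap m m) : Prop :=
  [/\ Box phi, cotransverse psi & f = cube_comp phi psi].

(* Every cotransverse map has exactly one cube_factorization, so quantifying
   over all of them refers to that one. *)
Definition thick (A : mapclass) : Prop :=
  forall m n (f : cubemap m n), A m n f ->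
  forall (phi : cubemap m n) (psi : cubemap m m),
    cube_factorization f phi psi -> A m m psi.

Definition thick_category_of_cubes (A : mapclass) : Prop :=
  category_of_cubes A /\ thick A.

Definition contains_no_symmetry (A : mapclass) : Prop :=
  forall n (i : 'I_n), ~ A n.+1 n.+1 (symmetry_map i).

Definition only_trivial_bijections (A : mapclass) : Prop :=
  forall n (f : cubemap n n), A n n f -> bijective f -> f = cube_id n.

Definition BoxHat : mapclass := fun m n phi =>
  cotransverse phi /\
  forall p (delta : cubemap p m), Box delta ->
    injective (cube_comp phi delta) -> Box (cube_comp phi delta).

Definition greatest (P : mapclass -> Prop) (A : mapclass) : Prop :=
  P A /\ forall B : mapclass, P B -> subclass B A.

(* Main.v *)
From mathcomp Require Import all_boot all_order all_fingroup all_algebra.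
Require Import Defs.

(** A maximal chain of [m] has m steps of length 1, and a cotransverse map
    f : [m] -> [n] keeps each of them of length 1; hence f preserves every
    finite distance ([cotransverseP]), and f(0...0) and f(1...1) are exactly m
    apart.  The image of f lies in the interval between these two vertices,
    which is a face of dimension m.  So f is a face map after a cotransverse
    endomorphism of [m] ([cube_factorization_exists]).

    Inclusion in BoxHat.  Let A be thick with trivial bijections, f in A and
    delta a face map with f delta one-to-one.  Write f delta = phi psi.  By
    thickness psi is in A; it is one-to-one on a finite set, hence bijective,
    hence the identity, and f delta = phi is a face map ([subclass_BoxHat]).

    BoxHat is itself thick.  If phi psi is in BoxHat with phi a face map, and
    psi delta is one-to-one, then phi psi delta is a face map; a face contained
    in the face phi is a face of it, so psi delta is a face map ([Box_cancel]).
    Taking delta to be the identity, a bijection in BoxHat is a face map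
    [n] -> [n], that is, the identity.

    Symmetries and bijections.  A cotransverse bijection of [n] preserves the
    number of ones, so it permutes the n atoms and is the coordinate
    permutation p that it induces on them ([injective_cotransverse_perm]).  If
    p is not the identity then it inverts some i < j; on the 2-dimensional face
    in the directions i and j the bijection is the exchange map of [2] followed
    by a face map, and thickness puts that exchange map in A
    ([thick_symmetry]).

    Face maps are handled through [BoxP]: they are the maps that copy their
    arguments, in order, to some coordinates of the target and freeze the other
    coordinates. *)

Set Implicit Arguments.
Unset Strict Implicit.
Unset Printing Implicit Defensive.

Import Order.TTheory.

(** * Distance and cotransverse maps *)

Definition diff (n : nat) (x y : cube n) : {set 'I_n} :=
  [set i | tnth x i != tnth y i].

Lemma le_cubeP (n : nat) (x y : cube n) :
  reflect (forall i, tnth x i -> tnth y i) (x <= y)%O.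
Proof.
rewrite leEtprod; apply: (iffP forallP) => h i; have := h i; rewrite leEbool /=.
  by case: (tnth x i) (tnth y i) => [] [].
by case: (tnth x i) (tnth y i) => [] [] // /(_ isT).
Qed.

Lemma cube_eqP (n : nat) (x y : cube n) :
  (forall i, tnth x i = tnth y i) -> x = y.
Proof. exact: (@eq_from_tnth n bool x y). Qed.

Lemma diff_eq0 (n : nat) (x y : cube n) : (diff x y == set0) = (x == y).
Proof.
apply/eqP/eqP => [/setP d0|->]; last by apply/setP=> i; rewrite !inE eqxx.
by apply: cube_eqP => i; move: (d0 i); rewrite !inE => /negbFE/eqP.
Qed.

Lemma dist1P (n : nat) (x y : cube n) (d : nat) :
  dist1 x y = Some d <-> (x <= y)%O /\ #|diff x y| = d.
Proof.
rewrite /dist1; have -> : #|diff x y| =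
    (\sum_(i < n) `|(tnth x i : nat) - (tnth y i : nat)|)%N.
  rewrite -sum1_card big_mkcond /=; apply: eq_bigr => i _.
  by rewrite inE; case: (tnth x i) (tnth y i) => [] [].
by case: ifP => _; split=> [[]|[]] // _ ->.
Qed.

(** Strict monotonicity is thereby a condition on [dist1], so that both halves
    of cotransversality are about distances. *)
Lemma lt_cubeP (n : nat) (x y : cube n) :
  (x < y)%O <-> exists d, dist1 x y = Some d.+1.
Proof.
rewrite lt_neqAle -diff_eq0 -cards_eq0; split=> [/andP[nxy xy]|[d /dist1P[xy c]]].
  by exists #|diff x y|.-1; apply/dist1P; split=> //; rewrite prednK // lt0n.
by rewrite c.
Qed.

Definition set_coord (n : nat) (x : cube n) (i : 'I_n) (a : bool) : cube n :=
  [tuple if j == i then a else tnth x j | j < n].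

(** Distances are realised by chains of unit steps: this is what turns the
    cotransversality condition, stated for unit steps only, into preservation
    of every finite distance. *)
Lemma dist1_step (n : nat) (x y : cube n) (d : nat) :
  dist1 x y = Some d.+1 ->
  exists2 z, dist1 x z = Some 1 & dist1 z y = Some d.
Proof.
move=> /dist1P[/le_cubeP xy c].
have [i iD] : exists i, i \in diff x y by apply/card_gt0P; rewrite c.
have [/negbTE xi yi] : ~~ tnth x i /\ tnth y i.
  move: iD (xy i); rewrite inE.
  by case: (tnth x i) (tnth y i) => [] [] // _ /(_ isT).
exists (set_coord x i true); apply/dist1P; split.
- by apply/le_cubeP => j; rewrite tnth_mktuple; case: eqP.
- have -> : diff x (set_coord x i true) = [set i]; last by rewrite cards1.
  apply/setP => j; rewrite !inE tnth_mktuple.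
  by case: (eqVneq j i) => [->|_]; rewrite ?xi ?eqxx.
- by apply/le_cubeP => j; rewrite tnth_mktuple; case: eqP => [-> //|_]; apply: xy.
- have -> : diff (set_coord x i true) y = diff x y :\ i.
    apply/setP => j; rewrite !inE tnth_mktuple.
    by case: (eqVneq j i) => [->|_] //=; rewrite yi.
  by apply/eqP; rewrite -eqSS -c (cardsD1 i (diff x y)) iD.
Qed.

Lemma dist1_trans (n : nat) (x y z : cube n) (d e : nat) :
  dist1 x y = Some d -> dist1 y z = Some e -> dist1 x z = Some (d + e).
Proof.
move=> /dist1P[xy <-] /dist1P[yz <-]; apply/dist1P; split.
  exact: le_trans xy yz.
have -> : diff x z = diff x y :|: diff y z.
  apply/setP => i; rewrite !inE; move/le_cubeP/(_ i): xy; move/le_cubeP/(_ i): yz.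
  by case: (tnth x i) (tnth y i) (tnth z i) => [] [] [] // h1 h2;
     rewrite ?h1 ?h2.
rewrite cardsU; have -> : diff x y :&: diff y z = set0; last first.
  by rewrite cards0 subn0.
apply/setP => i; rewrite !inE; move/le_cubeP/(_ i): xy; move/le_cubeP/(_ i): yz.
by case: (tnth x i) (tnth y i) (tnth z i) => [] [] [] // h1 h2;
   rewrite ?h1 ?h2 //; apply/esym; [have := h2 isT | have := h1 isT].
Qed.

Lemma cotransverseP (m n : nat) (f : cubemap m n) :
  cotransverse f <->
  forall x y d, dist1 x y = Some d -> dist1 (f x) (f y) = Some d.
Proof.
split=> [[_ f1] x y d|f_dist]; last first.
  split=> [x y /lt_cubeP[d /f_dist e]|x y /f_dist //].
  by apply/lt_cubeP; exists d.
elim: d x => [|d IHd] x; last first.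
  by case/dist1_step=> z /f1 xz /IHd zy; rewrite -add1n; apply: dist1_trans zy.
move=> /dist1P[_ /eqP]; rewrite cards_eq0 diff_eq0 => /eqP->.
by apply/dist1P; split=> //; apply/eqP; rewrite cards_eq0 diff_eq0.
Qed.

Lemma cotransverse_comp (m n p : nat) (g : cubemap n p) (f : cubemap m n) :
  cotransverse g -> cotransverse f -> cotransverse (cube_comp g f).
Proof.
move=> /cotransverseP g_dist /cotransverseP f_dist; apply/cotransverseP.
by move=> x y d xy; rewrite !ffunE; apply/g_dist/f_dist.
Qed.

(** * Faces preserve distances *)

Lemma coface_dist1 (n : nat) (i : 'I_n.+1) (a : bool) (x y : cube n) :
  dist1 (coface i a x) (coface i a y) = dist1 x y.
Proof.
rewrite /dist1 !ffunE.
rewrite (bigD1_ord i) //= !tnth_mktuple unlift_none distnn add0n.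
congr (if _ then Some _ else None).
  apply/le_cubeP/le_cubeP => xy j; last first.
    by rewrite !tnth_mktuple; case: unliftP => // k _; apply: xy.
  by have := xy (lift i j); rewrite !tnth_mktuple liftK.
by apply: eq_bigr => j _; rewrite !tnth_mktuple liftK.
Qed.

(** The equality also covers infinite distances, so it reflects distances as
    well as preserving them: besides cotransversality of faces it gives their
    injectivity and lets one cancel a face in front of a cotransverse map. *)
Lemma Box_dist1 (m n : nat) (f : cubemap m n) (x y : cube m) :
  Box f -> dist1 (f x) (f y) = dist1 x y.
Proof.
move=> Bf; elim: Bf x y => {m n f} [n i a|n|m n p g f _ IHg _ IHf] x y.
- exact: coface_dist1.
- by rewrite !ffunE.
- by rewrite !ffunE IHg IHf.
Qed.

Lemma Box_cotransverse (m n : nat) (f : cubemap m n) : Box f -> cotransverse f.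
Proof. by move=> Bf; apply/cotransverseP => x y d; rewrite Box_dist1. Qed.

Lemma Box_cancel_cotransverse (m n p : nat) (g : cubemap n p)
    (f : cubemap m n) :
  Box g -> cotransverse (cube_comp g f) -> cotransverse f.
Proof.
move=> Bg /cotransverseP gf_dist; apply/cotransverseP => x y d /gf_dist.
by rewrite !ffunE Box_dist1.
Qed.

Lemma Box_inj (m n : nat) (f : cubemap m n) : Box f -> injective f.
Proof.
move=> Bf x y e; have := Box_dist1 x y Bf; rewrite e.
have -> : dist1 (f y) (f y) = Some 0.
  by apply/dist1P; split=> //; apply/eqP; rewrite cards_eq0 diff_eq0.
by move=> /esym/dist1P[_ /eqP]; rewrite cards_eq0 diff_eq0 => /eqP.
Qed.

(** * Increasing maps between index sets *)

Definition increasing (m n : nat) (h : 'I_m -> 'I_n) : Prop :=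
  {homo h : i j / i < j}.

Lemma increasing_mono (m n : nat) (h : 'I_m -> 'I_n) :
  increasing h -> {mono h : i j / i < j}.
Proof.
move=> h_incr i j; case: (ltngtP i j) => [/h_incr|/h_incr|/val_inj->] //.
  by move=> ji; rewrite ltnNge ltnW.
by rewrite ltnn.
Qed.

Lemma increasing_inj (m n : nat) (h : 'I_m -> 'I_n) :
  increasing h -> injective h.
Proof.
move=> h_incr i j e.
by case: (ltngtP i j) => [/h_incr|/h_incr|/val_inj] //; rewrite e ltnn.
Qed.

Lemma increasing_ge (m n : nat) (h : 'I_m -> 'I_n) (k : 'I_m) :
  increasing h -> k <= h k.
Proof.
move=> h_incr; case: k => k; elim: k => [//|k IHk] km.
by apply: leq_ltn_trans (IHk (ltnW km)) _; apply: h_incr.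
Qed.

Lemma increasing_id (n : nat) (h : 'I_n -> 'I_n) : increasing h -> h =1 id.
Proof.
move=> h_incr k; apply/val_inj/eqP; rewrite /= eqn_leq increasing_ge // andbT.
(* The reverse inequality is the same bound for the reversed indexing. *)
have h'_incr : increasing (fun i => rev_ord (h (rev_ord i))).
  have rev_lt (i j : 'I_n) : i < j -> rev_ord j < rev_ord i.
    by move=> ij /=; rewrite ltn_sub2l // (leq_trans _ (ltn_ord j)).
  by move=> i j /rev_lt/h_incr/rev_lt.
have := increasing_ge (rev_ord k) h'_incr; rewrite rev_ordK /=.
by rewrite leq_sub2lE.
Qed.

(** * Faces as copies of coordinates *)

Definition face_along (m n : nat) (f : cubemap m n) (h : 'I_m -> 'I_n) : Prop :=
  (forall x k, tnth (f x) (h k) = tnth x k) /\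
  (forall x y j, j \notin codom h -> tnth (f x) j = tnth (f y) j).

Definition cube_const (n : nat) (a : bool) : cube n := [tuple a | _ < n].

(** If some coordinate [j] of the target is frozen, then [f] factors through the
    coface at [j] and the dimension of the target drops.  Otherwise [h] is an
    increasing bijection, hence the identity, and so is [f]. *)
Lemma face_along_Box (m n : nat) (f : cubemap m n) (h : 'I_m -> 'I_n) :
  increasing h -> face_along f h -> Box f.
Proof.
elim: n m f h => [|n IHn] m f h h_incr [f_h f_const].
  case: m f h h_incr f_h f_const => [|m] f h _ _ _; last by case: (h ord0).
  rewrite (_ : f = cube_id 0); first exact: Box_id.
  by apply/ffunP => x; apply: cube_eqP => -[].
have [/forallP h_surj|/forallPn[j jh]] := boolP [forall j, j \in codom h].
  have mn : m = n.+1.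
    rewrite -[m]card_ord -[n.+1]card_ord -(card_codom (increasing_inj h_incr)).
    by apply: eq_card => j; rewrite h_surj inE.
  subst m; rewrite (_ : f = cube_id _); first exact: Box_id.
  apply/ffunP => x; apply: cube_eqP => k.
  by rewrite ffunE -[in LHS](increasing_id h_incr k) f_h.
have [h' h'E] : exists h' : 'I_m -> 'I_n, forall k, h k = lift j (h' k).
  apply: (@fin_all_exists _ (fun=> 'I_n) (fun k i => h k = lift j i)) => k.
  case: (unliftP j (h k)) => [i ->|hk]; first by exists i.
  by rewrite -hk codom_f in jh.
pose f' : cubemap m n := [ffun x => [tuple tnth (f x) (lift j k) | k < n]].
have -> : f = cube_comp (coface j (tnth (f (cube_const m false)) j)) f'.
  apply/ffunP => x; apply: cube_eqP => i; rewrite !ffunE tnth_mktuple.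
  case: unliftP => [k ->|->]; first by rewrite tnth_mktuple.
  exact: f_const.
apply: Box_comp; first exact: Box_coface.
apply: (IHn _ _ h').
  move=> k l /h_incr; rewrite !h'E /=.
  by rewrite !ltnNge leq_bump2.
split=> [x k|x y k kh']; rewrite !ffunE !tnth_mktuple; first by rewrite -h'E f_h.
apply: f_const; apply: contra kh' => /codomP[l]; rewrite h'E.
by move=> /lift_inj->; apply: codom_f.
Qed.

(** A description of faces by their values, which does not depend on a choice
    of a word in the generating cofaces. *)
Lemma BoxP (m n : nat) (f : cubemap m n) :
  Box f <-> exists2 h, increasing h & face_along f h.
Proof.
split=> [Bf|[h h_incr fh]]; last exact: face_along_Box fh.
elim: Bf => {m n f} [n i a|n|m n p g f _ [hg hg_incr [g_h g_const]] _
                                      [hf hf_incr [f_h f_const]]].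
- exists (lift i); first by move=> k l kl; rewrite /= !ltnNge leq_bump2 -ltnNge.
  split=> [x k|x y j]; rewrite !ffunE !tnth_mktuple ?liftK //.
  by case: unliftP => // k ->; rewrite codom_f.
- exists id => //; split=> [x k|x y j]; rewrite !ffunE //.
  by move/negP; case; apply/codomP; exists j.
- exists (hg \o hf) => [k l kl|]; first exact/hg_incr/hf_incr.
  split=> [x k|x y j]; rewrite !ffunE /=; first by rewrite g_h f_h.
  have [/codomP[k ->] ghf|jg _] := boolP (j \in codom hg); last exact: g_const.
  rewrite !g_h; apply: f_const; apply: contra ghf => /codomP[l ->].
  by apply/codomP; exists l.
Qed.

(** The frozen coordinates of [g] are constant on the image of [cube_comp g f],
    so the free coordinates of the latter are among those of [g]; pulling them
    back along [g] gives the free coordinates of [f]. *)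
Lemma Box_cancel (m n p : nat) (g : cubemap n p) (f : cubemap m n) :
  Box g -> Box (cube_comp g f) -> Box f.
Proof.
move=> /BoxP[hg hg_incr [g_h g_const]] /BoxP[h h_incr [gf_h gf_const]].
have [hf hfE] : exists hf : 'I_m -> 'I_n, forall k, h k = hg (hf k).
  apply: (@fin_all_exists _ (fun=> 'I_n) (fun k i => h k = hg i)) => k.
  have [/codomP //|hk] := boolP (h k \in codom hg).
  have := gf_h (cube_const m true) k; have := gf_h (cube_const m false) k.
  by rewrite !ffunE !tnth_mktuple (g_const _ (f (cube_const m true)) _ hk) => ->.
apply/BoxP; exists hf.
  by move=> k l /h_incr; rewrite !hfE increasing_mono.
split=> [x k|x y j jhf].
  by rewrite -g_h -hfE -(gf_h x) ffunE.
rewrite -!g_h; have := gf_const x y (hg j); rewrite !ffunE; apply.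
apply: contra jhf => /codomP[k]; rewrite hfE => /(increasing_inj hg_incr)->.
exact: codom_f.
Qed.

Lemma Box_endo (n : nat) (f : cubemap n n) : Box f -> f = cube_id n.
Proof.
move=> /BoxP[h h_incr [f_h _]]; apply/ffunP => x; apply: cube_eqP => k.
by rewrite ffunE -[RHS]f_h increasing_id.
Qed.

(** * Faces from index maps, and the factorization *)

Definition face_map (m n : nat) (h : 'I_m -> 'I_n) (c : cube n) : cubemap m n :=
  [ffun x : cube m =>
     [tuple (if [pick k | h k == j] is Some k then tnth x k else tnth c j)
       | j < n] : cube n].

Lemma face_mapE (m n : nat) (h : 'I_m -> 'I_n) (c : cube n) x k :
  injective h -> tnth (face_map h c x) (h k) = tnth x k.
Proof.
move=> h_inj; rewrite ffunE tnth_mktuple; case: pickP => [l /eqP/h_inj-> //|].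
by move/(_ k); rewrite eqxx.
Qed.

Lemma face_map_out (m n : nat) (h : 'I_m -> 'I_n) (c : cube n) x j :
  j \notin codom h -> tnth (face_map h c x) j = tnth c j.
Proof.
move=> jh; rewrite ffunE tnth_mktuple; case: pickP => [l /eqP hl|//].
by rewrite -hl codom_f in jh.
Qed.

Lemma face_map_Box (m n : nat) (h : 'I_m -> 'I_n) (c : cube n) :
  increasing h -> Box (face_map h c).
Proof.
move=> h_incr; apply/BoxP; exists h => //; split=> [x k|x y j jh].
  exact/face_mapE/increasing_inj.
by rewrite !face_map_out.
Qed.

Lemma enum_val_increasing (n : nat) (S : {set 'I_n}) :
  increasing (@enum_val _ (mem S)).
Proof.
move=> i j ij; have x0 := enum_val i; rewrite !(enum_val_nth x0).
have s_sorted : sorted (fun x y : 'I_n => x < y) (enum S).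
  apply: (@subseq_sorted _ _ _ _ (enum 'I_n)).
  - exact: ltn_trans.
  - by rewrite {1}enumT; apply: filter_subseq.
  - by have := iota_ltn_sorted 0 n; rewrite -val_enum_ord sorted_map.
have lt_tr : transitive (fun x y : 'I_n => x < y) by move=> ? ? ?; apply: ltn_trans.
by apply: (sorted_ltn_nth lt_tr) => //; rewrite inE -cardE.
Qed.

(** The extreme vertices of the source are at distance [m]; this is where the
    dimension of the face spanned by [f] comes from. *)
Lemma cotransverse_card_diff (m n : nat) (f : cubemap m n) :
  cotransverse f ->
  #|diff (f (cube_const m false)) (f (cube_const m true))| = m.
Proof.
move=> /cotransverseP f_dist.
suff /f_dist/dist1P[_ //] : dist1 (cube_const m false) (cube_const m true) = Some m.
apply/dist1P; split; first by apply/le_cubeP => i; rewrite !tnth_mktuple.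
rewrite -[RHS]card_ord; apply: eq_card => i.
by rewrite !inE !tnth_mktuple.
Qed.

Lemma cotransverse_between (m n : nat) (f : cubemap m n) x :
  cotransverse f ->
  (f (cube_const m false) <= f x <= f (cube_const m true))%O.
Proof.
move=> /cotransverseP f_dist.
have f_le u v : (u <= v)%O -> (f u <= f v)%O.
  by move=> uv; have /f_dist/dist1P[] : dist1 u v = Some #|diff u v| by apply/dist1P.
by rewrite !f_le //; apply/le_cubeP => i; rewrite tnth_mktuple.
Qed.

(** The image of a cotransverse map lies in the interval between the images of
    the extreme vertices; these are at distance [m], so the interval is a face
    of dimension [m], and [psi] reads off its free coordinates. *)
Lemma cube_factorization_exists (m n : nat) (f : cubemap m n) :
  cotransverse f -> exists phi psi, cube_factorization f phi psi.
Proof.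
move=> f_cot; set D := diff (f (cube_const m false)) (f (cube_const m true)).
have cD : #|D| = m by exact: cotransverse_card_diff.
pose h (k : 'I_m) : 'I_n := enum_val (cast_ord (esym cD) k).
have h_incr : increasing h by move=> i j ij; apply: enum_val_increasing.
pose phi := face_map h (f (cube_const m false)).
pose psi : cubemap m m := [ffun x => [tuple tnth (f x) (h k) | k < m]].
have phiB : Box phi by exact: face_map_Box.
have fE : f = cube_comp phi psi.
  apply/ffunP => x; apply: cube_eqP => j; rewrite ffunE.
  have [/codomP[k ->]|jh] := boolP (j \in codom h).
    by rewrite face_mapE ?ffunE ?tnth_mktuple //; apply: increasing_inj.
  rewrite face_map_out //.
  (* [h] enumerates [D], so off its image the two extreme values agree. *)
  have jD : j \notin D.
    apply: contra jh => jD; apply/codomP.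
    by exists (cast_ord cD (enum_rank_in jD j)); rewrite /h cast_ordK enum_rankK_in.
  move: jD; rewrite inE negbK => /eqP j01.
  have /andP[/le_cubeP/(_ j) ge0 /le_cubeP/(_ j) le1] := cotransverse_between x f_cot.
  by apply/idP/idP => // /le1; rewrite j01.
exists phi, psi; split=> //.
by apply: (Box_cancel_cotransverse phiB); rewrite -fE.
Qed.

(** * Bijections and symmetries *)

(** The extreme vertices of [cube n] are at the largest possible distance, so
    [f] fixes the bottom one, and therefore preserves the number of ones.  Atoms
    thus go to atoms; call [p] the induced injection.  The image of [x] lies
    above the images of the atoms below [x], and has as many ones as there are
    such atoms, so it is their join. *)
Lemma injective_cotransverse_perm (n : nat) (f : cubemap n n) :
  cotransverse f -> injective f ->
  exists2 p : 'I_n -> 'I_n,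
    injective p & forall x k, tnth (f x) (p k) = tnth x k.
Proof.
move=> f_cot f_inj; pose o := cube_const n false.
have /cotransverseP f_dist := f_cot.
have fo i : tnth (f o) i = false.
  have oD : i \in diff (f o) (f (cube_const n true)).
    have /eqP-> : diff (f o) (f (cube_const n true)) == setT; last by rewrite inE.
    by rewrite eqEcard subsetT cardsT card_ord (cotransverse_card_diff f_cot) leqnn.
  have /andP[_] := cotransverse_between o f_cot.
  move=> /le_cubeP/(_ i); move: oD; rewrite inE -/o.
  by case: (tnth (f o) i) (tnth (f (cube_const n true)) i) => [] [] // _ /(_ isT).
pose supp (x : cube n) : {set 'I_n} := [set i | tnth x i].
have card_supp x : #|supp (f x)| = #|supp x|.
  have dist_o (y z : cube n) d : (forall i, tnth y i = false) ->
      dist1 y z = Some d <-> #|supp z| = d.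
    move=> y0; have yz : diff y z = supp z.
      by apply/setP => i; rewrite !inE y0; case: (tnth z i).
    split=> [/dist1P[_]|zd]; first by rewrite yz.
    apply/dist1P; rewrite yz; split=> //.
    by apply/le_cubeP => i; rewrite y0.
  by apply/(dist_o _ _ _ fo)/f_dist/dist_o => // i; rewrite tnth_mktuple.
pose atom i := set_coord o i true.
have supp_atom i : supp (atom i) = [set i].
  by apply/setP => j; rewrite !inE !tnth_mktuple; case: eqP.
have [p pE] : exists p : 'I_n -> 'I_n, forall i, supp (f (atom i)) = [set p i].
  apply: (@fin_all_exists _ (fun=> 'I_n) (fun i j => supp (f (atom i)) = [set j])).
  by move=> i; apply/cards1P; rewrite card_supp supp_atom cards1.
have p_inj : injective p.
  move=> i j pij; apply/set1_inj; rewrite -!supp_atom; congr supp.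
  apply/f_inj/cube_eqP => k; move: (pE i); rewrite pij -pE => /setP/(_ k).
  by rewrite !inE.
have p_supp x : supp (f x) = p @: supp x.
  apply/esym/eqP; rewrite eqEcard card_imset // card_supp leqnn andbT.
  apply/subsetP => _ /imsetP[i xi ->].
  have : p i \in supp (f (atom i)) by rewrite pE set11.
  have ix : (atom i <= x)%O.
    by apply/le_cubeP => j; rewrite !tnth_mktuple; case: eqP => // -> _; rewrite inE in xi.
  have /f_dist/dist1P[/le_cubeP fix_le _] : dist1 (atom i) x = Some #|diff (atom i) x|.
    by apply/dist1P.
  by rewrite !inE; apply: fix_le.
exists p => // x k.
by have := mem_imset (supp x) k p_inj; rewrite -p_supp !inE.
Qed.

Lemma symmetry_map_neq_id (n : nat) (i : 'I_n) :
  symmetry_map i <> cube_id n.+1.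
Proof.
set a := widen_ord (leqnSn n) i; set b := lift ord0 i.
have ab : a != b by rewrite -val_eqE /= /bump /= neq_ltn ltnSn.
move=> /ffunP/(_ (set_coord (cube_const n.+1 false) a true)).
rewrite !ffunE => /(congr1 (fun x : cube n.+1 => tnth x b)).
by rewrite !tnth_mktuple tpermR eqxx eq_sym (negbTE ab).
Qed.

Lemma symmetry_map_bij (n : nat) (i : 'I_n) : bijective (symmetry_map i).
Proof.
have symK : involutive (symmetry_map i).
  by move=> x; apply: cube_eqP => j; rewrite !ffunE !tnth_mktuple tpermK.
exact: inv_bij symK.
Qed.

Definition pair_index (n : nat) (i j : 'I_n) (k : 'I_2) : 'I_n :=
  if k == ord0 then i else j.

Lemma pair_index_increasing (n : nat) (i j : 'I_n) :
  i < j -> increasing (pair_index i j).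
Proof. by move=> ij [[|[|k]] hk] [[|[|l]] hl]. Qed.

(** Where [p] inverts [i < j], the restriction of [f] to the face in the
    directions [i] and [j] has its free coordinates at [p j < p i], filled in
    the exchanged order: its factorization is the face with these free
    coordinates after the exchange of the two coordinates of [cube 2]. *)
Lemma thick_symmetry (A : mapclass) (n : nat) (f : cubemap n n)
    (p : 'I_n -> 'I_n) (i j : 'I_n) :
  thick_category_of_cubes A -> A n n f -> injective p ->
  (forall x k, tnth (f x) (p k) = tnth x k) ->
  i < j -> p j < p i -> A 2 2 (symmetry_map (ord0 : 'I_1)).
Proof.
move=> [[[_ A_comp] A_Box A_cot] A_thick] Af p_inj f_p ij pji.
pose o := cube_const n false.
have h_incr := pair_index_increasing ij; have h'_incr := pair_index_increasing pji.
pose delta := face_map (pair_index i j) o.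
pose phi := face_map (pair_index (p j) (p i)) o.
have delta_Box : Box delta by exact: face_map_Box.
have phi_Box : Box phi by exact: face_map_Box.
set s := symmetry_map _.
have fE : cube_comp f delta = cube_comp phi s.
  apply/ffunP => x; apply: cube_eqP => l.
  have [q _ qK] := injF_bij p_inj; rewrite -(qK l); move: (q l) => {l qK}l.
  rewrite (ffunE _ x) f_p (ffunE (fun y => phi (s y))).
  have e0 : widen_ord (leqnSn 1) ord0 = ord0 by apply/val_inj.
  have e1 : lift ord0 ord0 = ord_max :> 'I_2 by apply/val_inj.
  have s0 : tnth (s x) ord0 = tnth x ord_max.
    by rewrite ffunE tnth_mktuple e0 e1 tpermL.
  have s1 : tnth (s x) ord_max = tnth x ord0.
    by rewrite ffunE tnth_mktuple e0 e1 tpermR.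
  have h_inj := increasing_inj h_incr; have h'_inj := increasing_inj h'_incr.
  have [->|li] := eqVneq l i.
    by rewrite (face_mapE o x ord0 h_inj) (face_mapE o (s x) ord_max h'_inj) s1.
  have [->|lj] := eqVneq l j.
    by rewrite (face_mapE o x ord_max h_inj) (face_mapE o (s x) ord0 h'_inj) s0.
  rewrite !face_map_out ?tnth_mktuple //; apply/codomP => -[k];
    rewrite /pair_index; case: ifP => _ e.
  - by case/eqP: lj; apply: p_inj.
  - by case/eqP: li; apply: p_inj.
  - by rewrite e eqxx in li.
  - by rewrite e eqxx in lj.
have Afd : A 2 n (cube_comp f delta) by apply: A_comp => //; apply: A_Box.
apply: (A_thick _ _ _ Afd phi); split=> //.
by apply: (Box_cancel_cotransverse phi_Box); rewrite -fE; apply: A_cot.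
Qed.

Lemma no_symmetry_bijections (A : mapclass) :
  thick_category_of_cubes A ->
  (contains_no_symmetry A <-> only_trivial_bijections A).
Proof.
move=> At; split=> [noS n f Af f_bij|A_triv n i Ai]; last first.
  exact: (symmetry_map_neq_id (A_triv _ _ Ai (symmetry_map_bij i))).
have [[_ _ A_cot] _] := At.
have [p p_inj f_p] := injective_cotransverse_perm (A_cot _ _ _ Af) (bij_inj f_bij).
suff p_incr : increasing p.
  apply/ffunP => x; apply: cube_eqP => k.
  by rewrite ffunE -[LHS](congr1 _ (increasing_id p_incr k)) f_p.
move=> i j ij; case: (ltngtP (p i) (p j)) => [//|pji|/val_inj/p_inj ijE].
  by case: (noS _ ord0 (thick_symmetry At Af p_inj f_p ij pji)).
by rewrite ijE ltnn in ij.
Qed.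

(** * Thick categories without symmetries *)

(** The endomorphism in the factorization of an injective [cube_comp f delta] is
    injective, hence a bijection of a finite set, and thickness puts it in [A],
    where bijections are trivial: what remains is the face. *)
Lemma subclass_BoxHat (A : mapclass) :
  thick_category_of_cubes A -> only_trivial_bijections A -> subclass A BoxHat.
Proof.
move=> [[[_ A_comp] A_Box A_cot] A_thick] A_triv m n f Af.
split=> [|p delta delta_Box fd_inj]; first exact: A_cot.
have Afd : A p n (cube_comp f delta) by apply: A_comp => //; apply: A_Box.
have [phi [psi fact]] := cube_factorization_exists (A_cot _ _ _ Afd).
have [phi_Box _ fdE] := fact.
have psi_inj : injective psi.
  by move=> x y e; apply: fd_inj; rewrite fdE !(ffunE _ x, ffunE _ y) e.
have psi_id := A_triv _ _ (A_thick _ _ _ Afd _ _ fact) (injF_bij psi_inj).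
by rewrite fdE psi_id; apply: Box_comp => //; apply: Box_id.
Qed.

Lemma cube_compA (m n p q : nat) (h : cubemap p q) (g : cubemap n p)
    (f : cubemap m n) :
  cube_comp h (cube_comp g f) = cube_comp (cube_comp h g) f.
Proof. by apply/ffunP => x; rewrite !ffunE. Qed.

Lemma cube_comp_inj_right (m n p : nat) (g : cubemap n p) (f : cubemap m n) :
  injective (cube_comp g f) -> injective f.
Proof. by move=> gf_inj x y e; apply: gf_inj; rewrite !ffunE e. Qed.

(** If [cube_comp g f] is injective on a face then so is [f], so that [f] maps
    this face to a face, on which [g] is injective in turn. *)
Lemma BoxHat_category : is_category BoxHat.
Proof.
split=> [n|m n p g f [g_cot g_hat] [f_cot f_hat]].
  split=> [|p delta delta_Box _]; first exact/Box_cotransverse/Box_id.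
  by apply: Box_comp => //; apply: Box_id.
split=> [|q delta delta_Box]; first exact: cotransverse_comp.
rewrite -cube_compA => gfd_inj; apply: g_hat => //.
by apply: f_hat => //; apply: cube_comp_inj_right gfd_inj.
Qed.

(** For thickness, [Box_cancel] removes the face [phi] from in front of
    [cube_comp psi delta]. *)
Lemma BoxHat_thick_category : thick_category_of_cubes BoxHat.
Proof.
split; first split.
- exact: BoxHat_category.
- move=> m n f Bf; split=> [|p delta delta_Box _]; first exact: Box_cotransverse.
  exact: Box_comp.
- by move=> m n f [].
move=> m n f [_ f_hat] phi psi [phi_Box psi_cot fE].
split=> [//|p delta delta_Box psid_inj].
apply: (Box_cancel phi_Box); rewrite cube_compA -fE; apply: f_hat => //.
rewrite fE -cube_compA => x y; rewrite (ffunE _ x) (ffunE _ y).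
by move/(Box_inj phi_Box)/psid_inj.
Qed.

Lemma BoxHat_trivial_bijections : only_trivial_bijections BoxHat.
Proof.
move=> n f [_ f_hat] f_bij; apply: Box_endo.
have fE : f = cube_comp f (cube_id n) by apply/ffunP => x; rewrite !ffunE.
by rewrite fE; apply: f_hat; [apply: Box_id|rewrite -fE; apply: bij_inj].
Qed.

Theorem theorem2p17 :
  (forall A : mapclass, thick_category_of_cubes A ->
     (contains_no_symmetry A <-> only_trivial_bijections A)) /\
  (forall A : mapclass, thick_category_of_cubes A ->
     only_trivial_bijections A -> subclass A BoxHat) /\
  greatest (fun A : mapclass =>
              thick_category_of_cubes A /\ contains_no_symmetry A)
           BoxHat.
Proof.
split; first exact: no_symmetry_bijections.
split; first exact: subclass_BoxHat.
split=> [|A [A_thick /(no_symmetry_bijections A_thick)]].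
  split; first exact: BoxHat_thick_category.
  apply/no_symmetry_bijections; first exact: BoxHat_thick_category.
  exact: BoxHat_trivial_bijections.
exact: subclass_BoxHat.
Qed.
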